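(* Let $1\ll n_1=\lambda n_2$ for a constant $0<\lambda\leq 1$, and let $G=G(n_1,n_2,p)$ where $(n_1n_2)^{-\frac{1}{2}}\ll p\ll (n_1n_2)^{-\frac{1}{2}+o(1)}$. Then whp $$(1-o(1))\frac{1}{2}pn_1n_2\leq g(G)\leq \frac{1}{2}pn_1n_2.$$
   Context: $G(n_1,n_2,p)$ denotes the binomial random bipartite graph: a random subgraph of $K_{n_1,n_2}$ (partition classes of sizes $n_1,n_2$) in which each edge is included independently with probability $p$. $g(G)$ is the genus of $G$. The notation $f\ll g$ means $f/g\to0$; $1\ll n_1$ means $n_1\to\infty$; ''whp'' means with probability tending to $1$ as $n_1\to\infty$; $o(1)$ denotes a quantity tending to $0$. *)

(* Defs.v *)
From HB Require Import structures.
From mathcomp Require Import all_boot all_order all_fingroup all_algebra.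
From mathcomp Require Import all_classical all_reals all_analysis.
Set Implicit Arguments. Unset Strict Implicit. Unset Printing Implicit Defensive.
Import Order.TTheory GRing.Theory Num.Theory.

(* Orientable genus of a finite simple graph, via rotation systems     *)
(* (Heffter-Edmonds-Ringel), extended additively over components.     *)
Section Genus.
Variables (V : finType) (adj : rel V).

Definition dart (d : V * V) : bool := adj d.1 d.2.
Definition rev_dart (d : V * V) : V * V := (d.2, d.1).

Definition rotation_system (r : {perm (V * V)}) : bool :=
  [forall d, dart d ==> (dart (r d) && ((r d).1 == d.1))] &&
  [forall d, forall d', (dart d && dart d' && (d.1 == d'.1)) ==> fconnect r d d'].

Definition face_step (r : {perm (V * V)}) (d : V * V) : V * V := r (rev_dart d).

(* faces of the embedding: orbits of face_step on darts, plus one face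
   for each isolated vertex (embedded alone in a sphere) *)
Definition num_faces (r : {perm (V * V)}) : nat :=
  #|[set [set y | fconnect (face_step r) d y] | d in [set d | dart d]]|
  + #|[set v : V | [forall w, ~~ adj v w]]|.

Definition num_edges : nat := #|[set d | dart d]| %/ 2.

Definition num_components : nat := #|[set [set y | connect adj x y] | x : V]|.

(* genus of the embedding given by r: Euler's formula
   V - E + F = 2 c - 2 g  summed over the components *)
Definition rot_genus (r : {perm (V * V)}) : nat :=
  ((2 * num_components + num_edges) - (#|V| + num_faces r)) %/ 2.

(* the genus: minimum over all rotation systems (one always exists; the
   default value (#|V|+1)^2 exceeds every rot_genus, so it is never attained) *)
Definition genus : nat :=
  \big[minn/(#|V| + 1) ^ 2]_(r : {perm (V * V)} | rotation_system r) rot_genus r.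
End Genus.

Definition bip_adj (n1 n2 : nat) (S : {set 'I_n1 * 'I_n2}) :
  rel ('I_n1 + 'I_n2)%type :=
  fun x y => match x, y with
             | inl i, inr j => (i, j) \in S
             | inr j, inl i => (i, j) \in S
             | _, _ => false
             end.

Definition bip_genus (n1 n2 : nat) (S : {set 'I_n1 * 'I_n2}) : nat :=
  genus (bip_adj S).

Definition Gnnp_prob (R : realType) (n1 n2 : nat) (p : R)
  (E : pred {set 'I_n1 * 'I_n2}) : R :=
  \sum_(S : {set 'I_n1 * 'I_n2} | E S)
     (p ^+ #|S| * (1 - p) ^+ (n1 * n2 - #|S|))%R.

(* Main.v *)
Require Import Defs.
From HB Require Import structures.
From mathcomp Require Import all_boot all_order all_fingroup all_algebra.
From mathcomp Require Import all_classical all_reals all_analysis.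
From mathcomp Require Import zify ring lra.
Import Order.TTheory GRing.Theory Num.Theory.
Import numFieldNormedType.Exports.
Set Implicit Arguments. Unset Strict Implicit. Unset Printing Implicit Defensive.

(* Every rotation system has E - V + 2c - 2g faces, so the genus is governed
   by the number of edges once faces and vertices are shown to be few.

   Lower bound.  Let L be a constant.  At most 2E/L faces have length at least L.
   A shorter face either backtracks at a vertex of degree 1 (at most V such
   faces) or contains a cycle of length less than L.  The expected number of
   cycles of length m is at most (Vp)^m, which is o(V) because
   p = (n1 n2)^(-1/2+o(1)).  As V = o(E), all but o(E) of Euler's formula is E.

   Upper bound.  Each component contributes a face, and at most (V + I)/2 components
   exist, where I counts the isolated vertices, so 4g <= 2E + I - V.  Since I <= V/2
   and |E - p n1 n2| <= V/4 with high probability, the negative term V absorbs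
   the fluctuations of E.

   The three failure events are controlled by the expectation of a single random
   variable.  It tends to 0 for each fixed L; a diagonal argument then lets L grow. *)

(** * Faces of rotation systems *)

Section Embeddings.
Variables (V : finType) (adj : rel V).

(** Each vertex turns its neighbours in the cyclic order of their enumeration. Outside that list
    [next] is the identity, which makes the map a permutation of all pairs. *)
Lemma rotation_system_exists : exists r, rotation_system adj r.
Proof.
pose turn (d : V * V) := (d.1, next (enum (adj d.1)) d.2).
have turn_inj : injective turn.
  move=> [x y] [x' y'] [/= <-] /(can_inj (prev_next (enum_uniq _))) -> //.
have iter_turn x y k : iter k turn (x, y) = (x, iter k (next (enum (adj x))) y).
  by elim: k => //= k ->.
exists (perm turn_inj); apply/andP; split.
  apply/forallP => -[x y]; apply/implyP; rewrite /dart /= => xy.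
  rewrite permE /= eqxx andbT.
  have : next (enum (adj x)) y \in enum (adj x) by rewrite mem_next mem_enum.
  by rewrite mem_enum.
apply/forallP => -[x y]; apply/forallP => -[x' y']; apply/implyP.
rewrite /dart /= => /andP[/andP[xy xy'] /eqP e]; subst x'.
have xyE : y \in enum (adj x) by rewrite mem_enum.
have : fconnect (next (enum (adj x))) y y'.
  by rewrite (fconnect_cycle (cycle_next (enum_uniq _)) xyE) mem_enum.
move=> /iter_findex <-; rewrite -iter_turn.
rewrite (eq_fconnect (permE turn_inj)).
exact: fconnect_iter.
Qed.

Hypotheses (adj_sym : symmetric adj) (adj_irr : irreflexive adj).

Definition darts : {set V * V} := [set d | dart adj d]%SET.
Definition isolated_vertices : {set V} := [set v | [forall w, ~~ adj v w]]%SET.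
Definition component (x : V) : {set V} := [set y | connect adj x y]%SET.

(** A component with a single vertex comes from an isolated vertex; every other one uses at least
    two vertices. *)
Lemma num_components_le :
  2 * num_components adj <= #|V| + #|isolated_vertices|.
Proof.
have symc := sym_connect_sym adj_sym.
have eqc : {in [set: V] & &, equivalence_rel (connect adj)}.
  move=> x y z _ _ _; split; first exact: connect0.
  by move=> xy; rewrite (same_connect symc xy).
have := card_partition (equivalence_partitionP eqc).
rewrite cardsT /equivalence_partition.
have -> : ([set [set y in [set: V] | connect adj x y] | x in [set: V]]
    = [set component x | x : V])%SET.
  by apply/setP => A; apply/imsetP/imsetP => -[x _ ->]; exists x => //;
    apply/setP => y; rewrite !inE.
rewrite /num_components -/component => ->.
set P := imset _ _.
have small : \sum_(A in P) (#|A| == 1) <= #|isolated_vertices|.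
  under eq_bigr => A _ do rewrite -[nat_of_bool _]/(if _ then 1 else 0).
  rewrite -big_mkcondr sum1dep_card.
  apply: leq_trans (leq_imset_card component isolated_vertices); apply: subset_leq_card.
  apply/fintype.subsetP => A; rewrite inE => /andP[/imsetP[x _ ->] /eqP c1].
  apply/imsetP; exists x => //; rewrite inE; apply/forallP => w.
  apply/negP => xw; have : [set x; w]%SET \subset component x.
    apply/fintype.subsetP => z; rewrite !inE => /orP[] /eqP ->; first exact: connect0.
    exact: connect1.
  move/subset_leq_card; rewrite c1 cards2.
  by case: eqP xw => // <-; rewrite adj_irr.
apply: leq_trans (leq_add (leqnn _) small).
rewrite -big_split /= mulnC -sum_nat_const; apply: leq_sum => A.
case/imsetP => x _ ->.
have : 0 < #|component x| by apply/card_gt0P; exists x; rewrite inE connect0.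
by case: (#|component x|) => [|[|]].
Qed.

(** * Faces as orbits of a fixed rotation system *)

Section Rotation.
Variable r : {perm (V * V)}.
Hypothesis rP : rotation_system adj r.

Lemma rot_dart d : dart adj d -> dart adj (r d).
Proof. by case/andP: rP => /forallP/(_ d)/implyP H _ /H /andP[]. Qed.

Lemma rot_fst d : dart adj d -> (r d).1 = d.1.
Proof. by case/andP: rP => /forallP/(_ d)/implyP H _ /H /andP[_ /eqP]. Qed.

Lemma rot_connect d d' :
  dart adj d -> dart adj d' -> d.1 = d'.1 -> fconnect r d d'.
Proof.
case/andP: rP => _ /forallP/(_ d)/forallP/(_ d')/implyP H dd dd' e.
by apply: H; rewrite dd dd' e eqxx.
Qed.

Lemma face_step_inj : injective (face_step r).
Proof. by move=> [x y] [x' y'] /perm_inj [-> ->]. Qed.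

Lemma rev_dartP d : dart adj d -> dart adj (rev_dart d).
Proof. by rewrite /dart /= adj_sym. Qed.

Lemma face_step_dart d : dart adj d -> dart adj (face_step r d).
Proof. by move=> /rev_dartP /rot_dart. Qed.

Lemma face_step_fst d : dart adj d -> (face_step r d).1 = d.2.
Proof. by move=> /rev_dartP /rot_fst. Qed.

Lemma iter_face_step_dart d k : dart adj d -> dart adj (iter k (face_step r) d).
Proof. by move=> dd; elim: k => //= k; apply: face_step_dart. Qed.

Definition face (d : V * V) : {set V * V} :=
  [set y | fconnect (face_step r) d y]%SET.
Definition faces := [set face d | d in darts]%SET.

Lemma face_eq d d' : d' \in face d -> face d' = face d.
Proof.
rewrite inE => dd'; apply/setP => y; rewrite !inE.
by rewrite (same_connect (fconnect_sym face_step_inj) dd').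
Qed.

Lemma face_dart d d' : dart adj d -> d' \in face d -> dart adj d'.
Proof. by move=> dd; rewrite inE => /iter_findex <-; apply: iter_face_step_dart. Qed.

Lemma face_connect d d' : dart adj d -> d' \in face d -> connect adj d.1 d'.1.
Proof.
move=> dd; rewrite inE => /iter_findex <-.
elim: (findex _ _ _) => [|k IH] /=; first exact: connect0.
have dk := iter_face_step_dart k dd.
by rewrite (face_step_fst dk); apply: connect_trans IH (connect1 dk).
Qed.

(** A face never leaves its component, so [g] is well defined on faces. It reaches every component
    with an edge, and each isolated vertex counts as a face of its own. *)
Lemma num_components_le_faces : num_components adj <= num_faces adj r.
Proof.
have symc := sym_connect_sym adj_sym.
pose g (X : {set V * V}) := (\bigcup_(d in X) component d.1)%SET.
have gE d : dart adj d -> g (face d) = component d.1.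
  move=> dd; apply/setP => y; apply/bigcupP/idP => [[d' fd']|].
    by rewrite !inE; apply: connect_trans (face_connect dd fd').
  by move=> cy; exists d => //; rewrite inE connect0.
apply: leq_trans (leq_add (leq_imset_card g faces) (leq_imset_card component isolated_vertices)).
apply: leq_trans (leq_card_setU _ _); apply: subset_leq_card.
apply/fintype.subsetP => _ /imsetP[x _ ->]; rewrite inE.
have [ix|] := boolP (x \in isolated_vertices); first by rewrite orbC imset_f.
rewrite inE negb_forall => /existsP[w]; rewrite negbK => xw.
apply/orP; left; apply/imsetP; exists (face (x, w)).
  by apply: imset_f; rewrite inE.
by rewrite gE.
Qed.

Lemma sum_card_faces : \sum_(X in faces) #|X| = #|darts|.
Proof.
have eqf : {in darts & &, equivalence_rel (fconnect (face_step r))}.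
  move=> x y z _ _ _; split; first exact: connect0.
  by move=> xy; rewrite (same_connect (fconnect_sym face_step_inj) xy).
rewrite (card_partition (equivalence_partitionP eqf)).
suff -> : faces = equivalence_partition (fconnect (face_step r)) darts by [].
apply: eq_in_imset => d; rewrite inE => dd; apply/setP => y; rewrite !inE.
apply/idP/andP => [dy|[]//]; split=> //.
by apply: face_dart dd _; rewrite inE.
Qed.

Definition fixed_darts : {set V * V} := [set d | dart adj d && (r d == d)]%SET.

(** The rotation is transitive on the darts at a vertex, so a fixed dart is the only one there. *)
Lemma card_fixed_darts : #|fixed_darts| <= #|V|.
Proof.
rewrite -(@card_in_imset _ _ fst) ?max_card // => d d'.
rewrite !inE => /andP[dd /eqP rd] /andP[dd' _] e.
have /iter_findex <- := rot_connect dd dd' e.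
by elim: (findex _ _ _) => //= k <-.
Qed.

End Rotation.

(** Cycles with a base point and a direction: for m >= 3 each is counted 2m times, which is harmless
    in an upper bound. *)
Definition cycles (m : nat) : {set {ffun 'I_m -> V}} :=
  [set f : {ffun 'I_m -> V} | injectiveb f && [forall i, adj (f i) (f (ordS i))]]%SET.

Definition num_short_cycles (L : nat) : nat := \sum_(m < L) #|cycles m.+3|.

(* A closed walk without backtracking contains a cycle: cut it at the closest
   pair of equal vertices.  A face backtracks only at a vertex of degree 1,
   that is, at a dart fixed by the rotation. *)
Lemma short_face r d L : rotation_system adj r -> dart adj d ->
    #|face r d| < L ->
  exists2 d', d' \in face r d &
    d' \in fixed_darts r \/
    exists m : 'I_L, exists2 f, f \in cycles m.+3 & d' = (f ord0, f (ordS ord0)).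
Proof.
move=> rP dd; set l := #|_| => lL.
pose w i := iter i (face_step r) d; pose v i := (w i).1.
have wd i : dart adj (w i) by apply: iter_face_step_dart.
have wE i : w i = (v i, v i.+1).
  by rewrite /v /= face_step_fst //; case: (w i).
have wf i : w i \in face r d by rewrite inE fconnect_iter.
have vadj i : adj (v i) (v i.+1) by have := wd i; rewrite wE.
have lE : l = fingraph.order (face_step r) d.
  by rewrite /l /face cardsE /fingraph.order; apply: eq_card => y; rewrite !inE.
have l0 : 0 < l by rewrite lE fingraph.order_gt0.
have vl : v l = v 0 by rewrite /v /w lE iter_order //; apply: face_step_inj.
(* [k] is a gap between two visits of the face walk to the same vertex. The face length [l] is such
   a gap, so a least one exists. *)
pose P k := (0 < k) && `[< exists i, v i = v (i + k) >].
have exP : exists k, P k by exists l; rewrite /P l0; apply/asboolP; exists 0.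
have Pl : P l by rewrite /P l0; apply/asboolP; exists 0.
case: (ex_minnP exP) => k /andP[k0 /asboolP[i vi]] kmin.
have kl := kmin _ Pl.
case: k k0 vi kmin kl => [|[|[|m]]] // _ vi kmin kl.
(* Gap 1 would be a loop. Gap 2 is a backtrack, where the rotation fixes a dart. From gap 3 on,
   minimality makes the vertices in between distinct. *)
- by have := vadj i; rewrite {1}vi addn1 adj_irr.
- have e : w i.+1 = rev_dart (w i) by rewrite !wE /rev_dart /= vi addn2.
  have re : r (w i.+1) = w i.+1 by rewrite [in LHS]e.
  by exists (w i.+1) => //; left; rewrite inE wd re eqxx.
have mL : m < L by lia.
exists (w i) => //; right; exists (Ordinal mL).
exists [ffun a : 'I_m.+3 => v (i + a)]; last first.
  by rewrite !ffunE /= wE addn0 modn_small // addn1.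
rewrite inE; apply/andP; split.
  apply/injectiveP => a b; rewrite !ffunE => ab.
  have key (a' b' : nat) : a' < b' -> b' < m.+3 -> v (i + a') = v (i + b') -> False.
    move=> ltab ltb e; have : P (b' - a').
      rewrite /P subn_gt0 ltab; apply/asboolP; exists (i + a').
      by rewrite e; congr v; lia.
    by move/kmin; lia.
  apply/val_inj => /=; case: (ltngtP a b) => // lt.
    by case: (key _ _ lt (ltn_ord b) ab).
  by case: (key _ _ lt (ltn_ord a) (esym ab)).
apply/forallP => a; rewrite !ffunE /=.
have := ltn_ord a; rewrite leq_eqVlt => /orP[/eqP e|lt].
  rewrite [X in X %% _]e modnn addn0.
  have := vadj (i + a).
  have -> : (i + a).+1 = i + m.+3 by rewrite -addnS; congr (i + _).
  by rewrite -vi.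
by rewrite modn_small // addnS.
Qed.

(** Face lengths add up to the number of darts, which bounds the long faces. A short face contains a
    fixed dart or the first dart of a short cycle, and any of its darts determines it. *)
Lemma num_faces_le r L : rotation_system adj r ->
  L * #|faces r| <= #|darts| + L * (#|V| + num_short_cycles L).
Proof.
move=> rP.
pose long := [set X in faces r | L <= #|X|]%SET.
pose short := [set X in faces r | #|X| < L]%SET.
have facesE : #|faces r| <= #|long| + #|short|.
  apply: leq_trans (leq_card_setU _ _); apply: subset_leq_card.
  by apply/fintype.subsetP => X XF; rewrite !inE XF /= leqNgt; case: (_ < _).
have longE : L * #|long| <= #|darts|.
  rewrite -(sum_card_faces rP) mulnC -sum_nat_const.
  rewrite [X in _ <= X](bigID (fun X : {set V * V} => L <= #|X|)) /=.
  apply: leq_trans (leq_addr _ _).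
  have -> : \sum_(X in long) L = \sum_(X in faces r | L <= #|X|) L.
    by apply: eq_bigl => X; rewrite inE.
  by apply: leq_sum => X /andP[].
have shortE : #|short| <= #|V| + num_short_cycles L.
  pose D (m : 'I_L) := [set ((f : {ffun 'I_m.+3 -> V}) ord0, f (ordS ord0)) | f in cycles m.+3]%SET.
  pose U := (fixed_darts r :|: \bigcup_(m < L) D m)%SET.
  apply: (@leq_trans #|U|).
    apply: leq_trans (leq_imset_card (face r) U); apply: subset_leq_card.
    apply/fintype.subsetP => X; rewrite inE => /andP[/imsetP[d dd ->] dL].
    rewrite inE in dd; have [d' d'f H] := short_face rP dd dL.
    rewrite -(face_eq d'f); apply: imset_f; rewrite inE.
    case: H => [->//|[m [f fc ->]]]; apply/orP; right.
    by apply/bigcupP; exists m => //; apply: imset_f.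
  apply: leq_trans (leq_card_setU _ _) _; apply: leq_add (card_fixed_darts rP) _.
  apply: (big_ind2 (fun (A : {set V * V}) n => #|A| <= n)).
  - by rewrite cards0.
  - move=> A n B k An Bk; apply: leq_trans (leq_card_setU _ _) _.
    exact: leq_add.
  - by move=> m _; apply: leq_imset_card.
nia.
Qed.

(** One rotation system suffices. With F >= c, Euler's formula gives 2g <= c + E - V, and 2c <= V +
    I finishes. *)
Lemma genus_le : 4 * genus adj <= 2 * num_edges adj + #|isolated_vertices| - #|V|.
Proof.
have [r rP] := rotation_system_exists.
have gr : genus adj <= rot_genus adj r by rewrite /genus -minEnat -leEnat; apply: bigmin_le_cond.
have := num_components_le_faces rP; have := num_components_le.
rewrite /rot_genus in gr; lia.
Qed.

(** The bound is proved for every rotation system and passes to the minimum. The three copies of V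
    come from Euler's formula, the isolated vertices and the fixed darts; the 1 absorbs the rounding
    in [rot_genus]. *)
Lemma le_genus L : L * num_edges adj <=
  L * (2 * genus adj + 3 * #|V| + num_short_cycles L + 1) + #|darts|.
Proof.
(* This covers the default value of the minimum. *)
have E2 : num_edges adj <= (#|V| + 1) ^ 2.
  have : #|darts| <= #|V| * #|V| by rewrite -card_prod max_card.
  by rewrite /num_edges -/darts expnS expn1; move: #|darts| #|V| => a b; nia.
rewrite /genus; apply: (big_ind (fun g => L * num_edges adj <=
  L * (2 * g + 3 * #|V| + num_short_cycles L + 1) + #|darts|)).
- apply: leq_trans (leq_addr _ _); rewrite leq_mul2l; apply/orP; right.
  by move: ((#|V| + 1) ^ 2) E2 => D E2; lia.
- by move=> a b ha hb; rewrite /minn; case: ifP.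
move=> r rP; have := num_faces_le L rP.
have iV : #|isolated_vertices| <= #|V| by apply: max_card.
have nf : num_faces adj r = #|faces r| + #|isolated_vertices| by [].
have : num_edges adj <= 2 * rot_genus adj r + 1 + (#|V| + num_faces adj r).
  by rewrite /rot_genus; lia.
rewrite nf; nia.
Qed.

End Embeddings.

(** * Bipartite graphs *)

Section Bipartite.
Variables n1 n2 : nat.
Local Notation cell := ('I_n1 * 'I_n2)%type.
Local Notation V := ('I_n1 + 'I_n2)%type.
Implicit Type S : {set cell}.

Lemma bip_adj_sym S : symmetric (bip_adj S).
Proof. by move=> [i|j] [i'|j']. Qed.

Lemma bip_adj_irr S : irreflexive (bip_adj S).
Proof. by move=> [i|j]. Qed.

Lemma card_bip_darts S : #|darts (bip_adj S)| = 2 * #|S|.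
Proof.
pose f (c : cell) : V * V := (inl c.1, inr c.2).
pose g (c : cell) : V * V := (inr c.2, inl c.1).
have fI : injective f by move=> [? ?] [? ?] [-> ->].
have gI : injective g by move=> [? ?] [? ?] [-> ->].
have -> : darts (bip_adj S) = (f @: S :|: g @: S)%SET.
  apply/setP => -[x y]; rewrite !inE /dart /=; apply/idP/orP.
    case: x y => [i|j] [i'|j'] //= H; [left|right]; apply/imsetP.
      by exists (i, j').
    by exists (i', j).
  by case=> /imsetP[[i j] ijS [-> ->]].
rewrite cardsU !card_imset // (_ : _ :&: _ = finset.set0)%SET ?cards0 ?subn0 ?mul2n ?addnn //.
by apply/setP => x; rewrite !inE; apply/andP => -[/imsetP[? _ ->] /imsetP[? _]].
Qed.

Lemma num_edges_bip S : num_edges (bip_adj S) = #|S|.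
Proof. by rewrite /num_edges -/(darts _) card_bip_darts mulKn. Qed.

Definition row_cells (i : 'I_n1) : {set cell} := [set (i, j) | j : 'I_n2]%SET.
Definition col_cells (j : 'I_n2) : {set cell} := [set (i, j) | i : 'I_n1]%SET.

Lemma card_row_cells i : #|row_cells i| = n2.
Proof. by rewrite card_imset ?card_ord // => ? ? []. Qed.

Lemma card_col_cells j : #|col_cells j| = n1.
Proof. by rewrite card_imset ?card_ord // => ? ? []. Qed.

Lemma card_isolated_bip S : #|isolated_vertices (bip_adj S)| <=
  \sum_(i < n1) ((S :&: row_cells i == finset.set0)%SET : nat) +
  \sum_(j < n2) ((S :&: col_cells j == finset.set0)%SET : nat).
Proof.
pose b (v : V) : nat := match v with
  | inl i => (S :&: row_cells i == finset.set0)%SET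
  | inr j => (S :&: col_cells j == finset.set0)%SET end.
rewrite -[X in _ <= X]/(\sum_(i < n1) b (inl i) + \sum_(j < n2) b (inr j)).
have -> : \sum_(i < n1) b (inl i) + \sum_(j < n2) b (inr j) = \sum_v b v.
  by rewrite big_sumType.
rewrite -sum1_card big_mkcond /=; apply: leq_sum => v _.
rewrite inE; case: ifP => // /forallP iv.
suff -> : b v = 1 by [].
case: v iv => [i|j] iv; rewrite /b; case: eqP => // -[];
  apply/setP => -[i' j']; rewrite !inE; apply/andP => -[ijS /imsetP[x _ [e1 e2]]].
  by have := iv (inr j'); rewrite /= -e1 ijS.
by have := iv (inl i'); rewrite /= -e2 ijS.
Qed.

Definition cell_of (x y : V) : option cell :=
  match x, y with
  | inl i, inr j | inr j, inl i => Some (i, j)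
  | _, _ => None
  end.

Lemma bip_adjE S x y :
  bip_adj S x y = if cell_of x y is Some c then c \in S else false.
Proof. by case: x y => [i|j] [i'|j']. Qed.

Lemma cell_of_eq x y x' y' c : cell_of x y = Some c -> cell_of x' y' = Some c ->
  (x = x' /\ y = y') \/ (x = y' /\ y = x').
Proof.
by case: x y x' y' => [?|?] [?|?] [?|?] [?|?] //= <- [-> ->]; [left|right|right|left].
Qed.

(** A cycle of length m+3 forces m+3 distinct edges, hence has probability at most p^(m+3). The set
    [S0] certifies that consecutive vertices of [f] lie in opposite classes. *)
Lemma cycle_cells m (f : {ffun 'I_m.+3 -> V}) S0 : f \in cycles (bip_adj S0) m.+3 ->
  exists2 T : {set cell}, #|T| = m.+3 &
    forall S, f \in cycles (bip_adj S) m.+3 -> (T \subset S)%SET.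
Proof.
rewrite inE => /andP[/injectiveP fI /forallP f0].
pose g i := cell_of (f i) (f (ordS i)).
have gS S i : bip_adj S (f i) (f (ordS i)) ->
    exists2 c, g i = Some c & c \in S.
  by rewrite bip_adjE -/(g i); case: (g i) => // c cS; exists c.
exists [set c | Some c \in codom g]%SET; last first.
  move=> S; rewrite inE => /andP[_ /forallP fS]; apply/fintype.subsetP => c.
  rewrite inE => /codomP[i ci]; have [c' c'i c'S] := gS _ _ (fS i).
  by move: c'i; rewrite -ci => -[->].
(* Two steps over the same edge either start at the same vertex or run in opposite directions. The
   latter would give b = b + 2 modulo m+3, which is impossible. *)
have gI : injective g.
  move=> a b ab; have [c ca _] := gS _ _ (f0 a).
  have cb : g b = Some c by rewrite -ab.
  have [[/fI//]|[/fI e1 /fI e2]] := cell_of_eq ca cb.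
  have ltb := ltn_ord b; have := congr1 val e2; rewrite e1 /=.
  have [lt|ge] := ltnP b.+1 m.+3.
    rewrite (modn_small lt); have [lt2|ge2] := ltnP b.+2 m.+3.
      by rewrite (modn_small lt2); lia.
    have -> : b.+2 = m.+3 by lia.
    by rewrite modnn; lia.
  have -> : b.+1 = m.+3 by lia.
  by rewrite modnn modn_small //; lia.
rewrite -(card_imset _ (@Some_inj _)) -[RHS](card_ord m.+3).
rewrite -(card_codom gI) -[in RHS]cardsE; apply: eq_card => x; rewrite !inE.
apply/imsetP/idP => [[c]|]; first by rewrite inE => ? ->.
move=> /codomP[i ->]; have [c ci _] := gS _ _ (f0 i).
by exists c => //; rewrite inE -ci codom_f.
Qed.

End Bipartite.

(** * Random subsets *)

Section BinomialSubset.
Local Open Scope ring_scope.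
Variables (R : realType) (T : finType) (p : R).
Hypothesis p01 : 0 <= p <= 1.
Implicit Types (S A : {set T}) (X Y : {set T} -> R).

Definition subset_weight S : R := p ^+ #|S| * (1 - p) ^+ (#|T| - #|S|).
Definition expect X : R := \sum_S subset_weight S * X S.

Lemma subset_weight_ge0 S : 0 <= subset_weight S.
Proof. by case/andP: p01 => p0 p1; rewrite mulr_ge0 ?exprn_ge0 ?subr_ge0. Qed.

Lemma le_expect X Y : (forall S, X S <= Y S) -> expect X <= expect Y.
Proof. by move=> XY; apply: ler_sum => S _; rewrite ler_wpM2l ?subset_weight_ge0. Qed.

Lemma eq_expect X Y : (forall S, X S = Y S) -> expect X = expect Y.
Proof. by move=> XY; apply: eq_bigr => S _; rewrite XY. Qed.

Lemma expectD X Y : expect (fun S => X S + Y S) = expect X + expect Y.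
Proof. by rewrite -big_split; apply: eq_bigr => S _; rewrite mulrDr. Qed.

Lemma expectZ a X : expect (fun S => a * X S) = a * expect X.
Proof. by rewrite big_distrr; apply: eq_bigr => S _; rewrite mulrCA. Qed.

Lemma expect_sum (I : finType) (P : pred I) (F : I -> {set T} -> R) :
  expect (fun S => \sum_(i | P i) F i S) = \sum_(i | P i) expect (F i).
Proof. by rewrite exchange_big; apply: eq_bigr => S _; rewrite big_distrr. Qed.

(** Expanding the product of all [p + G c] yields one term per subset. As [G] vanishes on [A], only
    supersets of [A] survive; each factor equals p on [A] and 1 elsewhere. *)
Lemma expect_subset A : expect (fun S => (A \subset S)%SET%:R) = p ^+ #|A|.
Proof.
pose G c : R := if c \in A then 0 else 1 - p.
rewrite /expect; under eq_bigr => S _.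
  have -> : subset_weight S * (A \subset S)%SET%:R =
      \prod_c (if c \in S then p else G c).
    rewrite (bigID (mem S)) /=.
    rewrite (eq_bigr (fun=> p)); last by move=> c /= ->.
    rewrite [X in _ = _ * X](eq_bigr G); last by move=> c /= /negbTE ->.
    rewrite prodr_const /subset_weight -mulrA; congr (_ * _).
    have [AS|/subsetPn[c cA cS]] := boolP (A \subset S)%SET; last first.
      by rewrite mulr0 (bigD1 c) //= /G cA mul0r.
    rewrite mulr1 (eq_bigr (fun=> 1 - p)).
      rewrite prodr_const; congr (_ ^+ _).
      by rewrite -(cardsC S) addKn; apply: eq_card => c; rewrite !inE.
    move=> c cS; rewrite /G; case: ifP => // cA.
    by rewrite (fintype.subsetP AS _ cA) in cS.
  over.
transitivity (\prod_c (p + G c)); first by rewrite bigA_distr.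
rewrite (bigID (mem A)) /=.
rewrite (eq_bigr (fun=> p)); last by move=> c cA; rewrite /G cA addr0.
rewrite prodr_const big1 ?mulr1 // => c /negbTE cA.
by rewrite /G cA; ring.
Qed.

Lemma expect_cst a : expect (fun=> a) = a.
Proof.
rewrite -[RHS]mulr1 -[X in _ = a * X](expr0 p) -(cards0 T) -expect_subset -expectZ.
by apply: eq_expect => S; rewrite finset.sub0set mulr1.
Qed.

Lemma expect_mem c : expect (fun S => (c \in S)%:R) = p.
Proof.
rewrite -[RHS]expr1 -(cards1 c) -expect_subset.
by apply: eq_expect => S; rewrite finset.sub1set.
Qed.

Lemma covariance_mem c d :
  expect (fun S => ((c \in S)%:R - p) * ((d \in S)%:R - p)) =
  if c == d then p * (1 - p) else 0.
Proof.
pose P := [set c; d]%SET.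
transitivity (expect (fun S => (P \subset S)%SET%:R +
    (- p * (c \in S)%:R + (- p * (d \in S)%:R + p ^+ 2)))).
  apply: eq_expect => S; rewrite /P finset.subUset !finset.sub1set.
  by case: (c \in S); case: (d \in S) => /=; ring.
rewrite !expectD !expectZ expect_subset !expect_mem expect_cst /P cards2.
by case: eqVneq => _ /=; ring.
Qed.

(** The square expands into covariances of indicators, and only the diagonal ones are nonzero. *)
Lemma variance_card A :
  expect (fun S => (#|S :&: A|%SET%:R - p * #|A|%:R) ^+ 2) = #|A|%:R * (p * (1 - p)).
Proof.
transitivity (expect (fun S => \sum_(c in A) \sum_(d in A)
    (((c \in S)%:R - p) * ((d \in S)%:R - p)))).
  apply: eq_expect => S; rewrite -big_distrlr /= -expr2; congr (_ ^+ 2).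
  rewrite sumrB sumr_const -[p *+ _]mulr_natr; congr (_ - _).
  rewrite -sum1_card natr_sum [RHS](bigID (mem S)) /= [X in _ + X]big1 ?addr0.
    rewrite [RHS](eq_bigr (fun=> 1)); last by move=> c /andP[_ ->].
    by apply: eq_big => [c|//]; rewrite inE andbC.
  by move=> c /andP[_ /negbTE ->].
rewrite expect_sum mulr_natl -sumr_const; apply: eq_bigr => c cA.
rewrite expect_sum; under eq_bigr => d _ do rewrite covariance_mem.
rewrite (bigD1 c) //= eqxx big1 ?addr0 // => d /andP[_ dc].
by rewrite eq_sym (negbTE dc).
Qed.

(** Chebyshev's inequality: if [S] misses [A], the count deviates from its mean [a] by exactly
    [a]. *)
Lemma expect_disjoint_le A : 0 < p -> (0 < #|A|)%N ->
  expect (fun S => ((S :&: A)%SET == finset.set0)%:R) <= (p * #|A|%:R)^-1.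
Proof.
move=> p0; rewrite -(ltr0n R) => A0; set a := p * _.
have a0 : 0 < a by rewrite mulr_gt0.
apply: (@le_trans _ _ (expect (fun S =>
    (a ^+ 2)^-1 * (#|S :&: A|%SET%:R - p * #|A|%:R) ^+ 2))).
  apply: le_expect => S; case: eqP => [->|_] /=.
    by rewrite cards0 sub0r sqrrN mulVf // expf_neq0 // gt_eqF.
  by rewrite mulr_ge0 ?sqr_ge0 // invr_ge0 sqr_ge0.
rewrite expectZ variance_card.
have -> : (a ^+ 2)^-1 * (#|A|%:R * (p * (1 - p))) = a^-1 * (1 - p).
  by rewrite /a; field; rewrite !gt_eqF.
by rewrite ler_piMr ?invr_ge0 ?(ltW a0) // gerBl ltW.
Qed.

(** Markov's inequality, in the pointwise form that 1 - X is at most the indicator of [E]. *)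
Lemma prob_ge (E : pred {set T}) X : (forall S, 0 <= X S) ->
  (forall S, X S < 1 -> E S) ->
  1 - expect X <= \sum_(S | E S) subset_weight S.
Proof.
move=> X0 XE; rewrite -{1}(expect_cst 1) -mulN1r -expectZ -expectD.
rewrite big_mkcond; apply: ler_sum => S _; rewrite mulN1r.
have w0 := subset_weight_ge0 S; case: ifPn => [_|nE].
  by rewrite ler_piMr // gerBl.
rewrite mulr_ge0_le0 // subr_le0 leNgt; apply/negP => /XE; exact/negP.
Qed.

End BinomialSubset.

(** * The random bipartite graph *)

Section GenusOfBinomialBipartiteGraph.
Local Open Scope ring_scope.
Variables (R : realType) (n1 n2 : nat).
Local Notation cell := ('I_n1 * 'I_n2)%type.
Local Notation V := ((n1 + n2)%:R : R).
Local Notation N := ((n1 * n2)%:R : R).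

Lemma GnnpE (p : R) (E : pred {set cell}) :
  Gnnp_prob p E = \sum_(S | E S) subset_weight p S.
Proof. by apply: eq_bigr => S _; rewrite /subset_weight card_prod !card_ord. Qed.

Lemma Gnnp_prob_le1 (p : R) (E : pred {set cell}) : 0 <= p <= 1 -> Gnnp_prob p E <= 1.
Proof.
move=> p01; rewrite GnnpE -[leRHS](expect_cst cell p) /expect.
rewrite big_mkcond; apply: ler_sum => S _; rewrite mulr1.
by case: ifP => // _; apply: subset_weight_ge0.
Qed.

Definition isolated_bound (S : {set cell}) : R :=
  \sum_(i < n1) ((S :&: row_cells n2 i)%SET == finset.set0)%:R +
  \sum_(j < n2) ((S :&: col_cells n1 j)%SET == finset.set0)%:R.

Lemma isolated_boundP (S : {set cell}) :
  #|isolated_vertices (bip_adj S)|%:R <= isolated_bound S.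
Proof. by rewrite /isolated_bound -!natr_sum -natrD ler_nat card_isolated_bip. Qed.

Lemma expect_isolated_bound (p : R) : 0 < p -> p <= 1 -> (0 < n1)%N -> (0 < n2)%N ->
  expect p isolated_bound <= V * ((p * n1%:R)^-1 + (p * n2%:R)^-1).
Proof.
move=> p0 p1 n1p n2p; have p01 : 0 <= p <= 1 by rewrite ltW.
rewrite /isolated_bound expectD !expect_sum.
apply: (@le_trans _ _ (n1%:R * (p * n2%:R)^-1 + n2%:R * (p * n1%:R)^-1)).
  apply: lerD.
    rewrite -[n1 in leRHS]card_ord mulr_natl -sumr_const; apply: ler_sum => i _.
    have := expect_disjoint_le p01 (A := row_cells n2 i) p0.
    by rewrite card_row_cells => /(_ n2p).
  rewrite -[n2 in leRHS]card_ord mulr_natl -sumr_const; apply: ler_sum => j _.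
  have := expect_disjoint_le p01 (A := col_cells n1 j) p0.
  by rewrite card_col_cells => /(_ n1p).
have i1 : 0 <= (p * n1%:R)^-1 by rewrite invr_ge0 mulr_ge0 // ltW.
have i2 : 0 <= (p * n2%:R)^-1 by rewrite invr_ge0 mulr_ge0 // ltW.
have m1 : 0 <= n1%:R * (p * n1%:R)^-1 by rewrite mulr_ge0.
have m2 : 0 <= n2%:R * (p * n2%:R)^-1 by rewrite mulr_ge0.
by rewrite natrD; lra.
Qed.

(** First moment: there are V^(m+3) vertex sequences, and each is a cycle with probability at most
    p^(m+3), or never. *)
Lemma expect_short_cycles (p : R) L : 0 <= p <= 1 ->
  expect p (fun S : {set cell} => (num_short_cycles (bip_adj S) L)%:R) <=
  \sum_(m < L) (V * p) ^+ m.+3.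
Proof.
move=> p01.
rewrite (@eq_expect _ _ _ _ (fun S => \sum_(m < L)
    \sum_(f : {ffun 'I_m.+3 -> ('I_n1 + 'I_n2)%type})
      (f \in cycles (bip_adj S) m.+3)%:R)); last first.
  move=> S; rewrite natr_sum; apply: eq_bigr => m _.
  rewrite -sum1_card natr_sum big_mkcond; apply: eq_bigr => f _.
  by case: (f \in _).
rewrite expect_sum; apply: ler_sum => m _; rewrite expect_sum.
have -> : (V * p) ^+ m.+3 =
    \sum_(f : {ffun 'I_m.+3 -> ('I_n1 + 'I_n2)%type}) p ^+ m.+3.
  rewrite sumr_const card_ffun card_sum !card_ord exprMn -natrX mulr_natl.
  by [].
apply: ler_sum => f _.
have [[S0 fS0]|nf] := pselect (exists S0, f \in cycles (bip_adj S0) m.+3).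
  have [T Tm TS] := cycle_cells fS0; rewrite -[X in _ ^+ X]Tm -expect_subset.
  by apply: le_expect => // S; case: (boolP (f \in _)) => // /TS ->.
rewrite (@eq_expect _ _ _ _ (fun=> 0)); last first.
  by move=> S; case: (boolP (f \in _)) => // fS; case: nf; exists S.
by rewrite expect_cst; case/andP: p01 => p0 _; rewrite exprn_ge0.
Qed.

(** The summands bound the failure probabilities for the number of edges, the isolated vertices and
    the short cycles, in this order. *)
Definition genus_error (p : R) L : R :=
  4 * p + 2 * ((p * n1%:R)^-1 + (p * n2%:R)^-1) +
  V^-1 * \sum_(m < L) (V * p) ^+ m.+3.

Lemma genus_prob_ge (p e : R) L : (0 < n1)%N -> (0 < n2)%N -> 0 < p -> p <= 1 ->
  (0 < L)%N -> 4 <= e * L%:R -> 12 * V <= e * (p * N) ->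
  1 - genus_error p L <= Gnnp_prob p (fun S : {set cell} =>
    ((1 - e) * (1/2 * p * N) <= (bip_genus S)%:R) &&
    ((bip_genus S)%:R <= 1/2 * p * N)).
Proof.
move=> n1p n2p p0 p1 L0 eL eV; have p01 : 0 <= p <= 1 by rewrite ltW.
have V0 : 0 < V by rewrite ltr0n addn_gt0 n1p.
have V1 : 1 <= V by rewrite ler1n addn_gt0 n1p.
have N0 : 0 < N by rewrite ltr0n muln_gt0 n1p.
(* All three summands are nonnegative, so X < 1 forces |E - pN| <= V/4, I <= V/2 and at most V short
   cycles; the coefficients encode these thresholds. *)
pose X (S : {set cell}) : R := 16 * (V ^+ 2)^-1 * (#|S|%:R - p * N) ^+ 2 +
  (2 * V^-1 * isolated_bound S + V^-1 * (num_short_cycles (bip_adj S) L)%:R).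
have ib0 S : 0 <= isolated_bound S by rewrite addr_ge0 // sumr_ge0.
have T1 (S : {set cell}) : 0 <= 16 * (V ^+ 2)^-1 * (#|S|%:R - p * N) ^+ 2.
  by rewrite mulr_ge0 ?sqr_ge0 // mulr_ge0 // invr_ge0 sqr_ge0.
have T2 S : 0 <= 2 * V^-1 * isolated_bound S.
  by rewrite mulr_ge0 // mulr_ge0 // invr_ge0 ltW.
have T3 S : 0 <= V^-1 * (num_short_cycles (bip_adj (S : {set cell})) L)%:R.
  by rewrite mulr_ge0 // invr_ge0 ltW.
have EX : expect p X <= genus_error p L.
  rewrite /X /genus_error !expectD !expectZ -addrA; apply: lerD; last apply: lerD.
  - have -> : expect p (fun S : {set cell} => (#|S|%:R - p * N) ^+ 2) = N * (p * (1 - p)).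
      rewrite -[n1 in RHS]card_ord -[n2 in RHS]card_ord -card_prod -cardsT.
      rewrite -variance_card; apply: eq_expect => S.
      by rewrite finset.setIT cardsT card_prod !card_ord.
    rewrite -mulrA mulrCA ler_pdivrMl ?exprn_gt0 //.
    (* By the inequality of arithmetic and geometric means, the variance term is at most 4p. *)
    have : 4 * N <= V ^+ 2.
      rewrite natrD natrM; have := sqr_ge0 (n1%:R - n2%:R : R); nra.
    have : 0 <= N * p ^+ 2 by rewrite mulr_ge0 ?sqr_ge0 // ltW.
    nra.
  - rewrite -mulrA ler_pM2l // ler_pdivrMl //.
    exact: expect_isolated_bound.
  - by rewrite ler_pM2l ?invr_gt0 //; apply: expect_short_cycles.
apply: (@le_trans _ _ (1 - expect p X)); first by rewrite lerD2l lerN2.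
rewrite GnnpE; apply: prob_ge => // S; first by rewrite /X !addr_ge0.
rewrite /X => X1.
have C1 : (num_short_cycles (bip_adj S) L)%:R <= V.
  rewrite -[leRHS]mulr1 -ler_pdivrMl //.
  by have := T1 S; have := T2 S; lra.
have I1 : 2 * #|isolated_vertices (bip_adj S)|%:R <= V.
  apply: le_trans (_ : 2 * isolated_bound S <= _).
    by rewrite ler_pM2l // isolated_boundP.
  rewrite -[leRHS]mulr1 -ler_pdivrMl // mulrA [_^-1 * 2]mulrC.
  by have := T1 S; have := T3 S; lra.
have E1 : 16 * (#|S|%:R - p * N) ^+ 2 <= V ^+ 2.
  rewrite -[leRHS]mulr1 -ler_pdivrMl ?exprn_gt0 // mulrCA mulrA.
  by have := T2 S; have := T3 S; lra.
have {}E1 : `|4 * (#|S|%:R - p * N)| <= V.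
  rewrite -ler_sqr ?nnegrE ?normr_ge0 ?(ltW V0) //.
  by rewrite real_normK ?num_real // exprMn; lra.
move: E1; rewrite ler_norml => /andP[El Eu].
have sym := bip_adj_sym S; have irr := bip_adj_irr S.
have gl := genus_le sym irr; have gu := le_genus sym irr L.
move: gl gu; rewrite num_edges_bip card_bip_darts card_sum !card_ord -/(bip_genus S).
set g := bip_genus S; set I := #|isolated_vertices _| => gl gu.
have pN : 0 < p * N by rewrite mulr_gt0.
apply/andP; split.
  have {}gu : L%:R * #|S|%:R <= L%:R * (2 * g%:R + 3 * V +
      (num_short_cycles (bip_adj S) L)%:R + 1) + 2 * #|S|%:R.
    by move: gu; rewrite -(ler_nat R) !(natrM, natrD).
  have L0' : 0 < L%:R :> R by rewrite ltr0n.
  have g0 : 0 <= g%:R :> R by [].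
  (* For e >= 1 the lower bound is not positive. Otherwise L > 4, so that L - 2 is a positive factor
     for the edge estimate. *)
  have [e1|e1] := leP 1 e.
    have : 0 <= (e - 1) * (p * N) by rewrite mulr_ge0 ?subr_ge0 // ltW.
    by nra.
  have L4 : 4 < L%:R :> R.
    by apply: le_lt_trans eL _; rewrite gtr_pMl.
  rewrite -(ler_pM2l L0') -[1 / 2 * p * N]mulrA.
  (* The losses are 2pN from long faces and at most 6LV from the remaining terms. Each is at most
     half of e L p N, by [h2] and [h3] respectively. *)
  have h2 : 0 <= (e * L%:R - 4) * (p * N) by rewrite mulr_ge0 ?subr_ge0 // ltW.
  have h3 : 0 <= L%:R * (e * (p * N) - 12 * V) by rewrite mulr_ge0 // subr_ge0.
  have h4 : 0 <= (L%:R - 2) * (4 * (#|S|%:R - p * N) + V).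
    by apply: mulr_ge0; lra.
  have h5 : 0 <= L%:R * (V - (num_short_cycles (bip_adj S) L)%:R).
    by rewrite mulr_ge0 // subr_ge0.
  have h6 : 0 <= L%:R * (V - 1) by rewrite mulr_ge0 // subr_ge0.
  move: V0 L0' gu h2 h3 h4 h5 h6; move: (num_short_cycles _ _)%:R => C.
  move: (p * N) #|S|%:R V L%:R g%:R => x E v l G v0 l0 a1 a2 a3 a4 a5 a6; clear - v0 l0 a1 a2 a3 a4 a5 a6; lra.
(* The subtraction in [genus_le] is truncated: either it gives 0 and the genus vanishes, or it is a
   true difference. In the second case 4g <= 2pN + V/2 + V/2 - V. *)
have [le|lt] := leqP (2 * #|S| + I) (n1 + n2).
  have -> : g = 0%N by clear - gl le; lia.
  by rewrite -!mulrA !mulr_ge0 // ltW.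
have : 4 * g%:R + V <= 2 * #|S|%:R + I%:R.
  by rewrite -!natrM -!natrD ler_nat; clear - gl lt; lia.
by move: Eu I1; rewrite -/I; clear; lra.
Qed.

End GenusOfBinomialBipartiteGraph.

(** * Asymptotics *)

Local Open Scope classical_set_scope.
Local Open Scope ring_scope.

(** Let [K j] be a time after which the j-th sequence stays within 1/(j+1) of [l]. Then [J k] is the
    largest j <= k with [K j <= k]. *)
Lemma diagonal_cvg (R : realType) (q : nat -> nat -> R) (l : R) :
  (forall j, q j @ \oo --> l) ->
  exists2 J : nat -> nat, J @ \oo --> \oo & (fun k => q (J k) k) @ \oo --> l.
Proof.
move=> ql.
have /choice[K KP] : forall j, exists K, forall k, (K <= k)%N ->
    `|l - q j k| <= harmonic j.
  move=> j; have /cvgrPdist_le/(_ _ (harmonic_gt0 j)) := ql j.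
  by case=> K _ HK; exists K => k; apply: HK.
pose J k := (\max_(j < k.+1 | K j <= k) j)%N.
have Jlt k j : (j <= k)%N -> (K j <= k)%N -> (j <= J k)%N.
  move=> jk Kj; rewrite -ltnS in jk.
  exact: (@leq_bigmax_cond _ (fun i : 'I_k.+1 => K i <= k)%N _ (Ordinal jk)).
have JK k : (K 0 <= k)%N -> (K (J k) <= k)%N.
  (* The maximum is attained only if it ranges over some index; [K0] makes 0 one. *)
  move=> K0; rewrite /J.
  have [|i Ki ->//] := @eq_bigmax_cond _ (fun i : 'I_k.+1 => K i <= k)%N (@nat_of_ord _).
  by apply/card_gt0P; exists ord0.
have Joo : J @ \oo --> \oo.
  apply/cvgnyPge => M; exists (maxn M (K M)) => // k /=.
  by rewrite geq_max => /andP[]; apply: Jlt.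
exists J => //; apply/cvgrPdist_le => e e0.
have hJ : (fun k => harmonic (J k) : R) @ \oo --> 0.
  exact: cvg_comp Joo cvg_harmonic.
near=> k; apply: (@le_trans _ _ (harmonic (J k))).
  by apply: KP; apply: JK; near: k; exists (K 0).
by near: k; apply: (cvgr_le _ hJ).
Unshelve. all: by end_near. Qed.

Theorem theorem1p5 (R : realType) (lam : R) (n1 n2 : nat -> nat) (p : nat -> R) :
  0 < lam -> lam <= 1 ->
  (forall k, (n1 k)%:R = lam * (n2 k)%:R) ->
  (forall M : nat, \forall k \near \oo, (M <= n1 k)%N) ->
  (forall k, 0 <= p k <= 1) ->
  (fun k => p k * Num.sqrt ((n1 k * n2 k)%:R)) @ \oo --> +oo ->
  (exists eps : nat -> R, eps @ \oo --> (0 : R) /\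
     (fun k => p k / ((n1 k * n2 k)%:R `^ (- (1/2) + eps k))) @ \oo --> (0 : R)) ->
  exists delta : nat -> R, delta @ \oo --> (0 : R) /\
    (fun k : nat => Gnnp_prob (R := R) (n1 := n1 k) (n2 := n2 k) (p k)
        (fun S => ((1 - delta k) * (1/2 * p k * (n1 k * n2 k)%:R)
                    <= (bip_genus S)%:R)
                  && ((bip_genus S)%:R <= 1/2 * p k * (n1 k * n2 k)%:R)))
      @ \oo --> (1 : R).
Proof.
move=> lam0 lam1 n1E n1oo p01.
(* Everything is measured on the scale [s]: with a the square root of [lam], n1 = a s, n2 = s/a and
   n1 + n2 = c s. The hypotheses say that [w] tends to infinity but only as s^o(1). *)
pose s k : R := Num.sqrt (n1 k * n2 k)%:R; pose w k := p k * s k.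
rewrite -/w => woo [eps [eps0 peps]].
pose a := Num.sqrt lam.
have a0 : 0 < a by rewrite sqrtr_gt0.
have aa : a ^+ 2 = lam by rewrite sqr_sqrtr // ltW.
have a1 : a <= 1 by rewrite -sqrtr1 ler_wsqrtr.
have sE k : s k = a * (n2 k)%:R.
  rewrite /s natrM n1E -mulrA -expr2 sqrtrM ?ltW // sqrtr_sqr ger0_norm //.
have n2E k : (n2 k)%:R = a^-1 * s k by rewrite sE mulKf // gt_eqF.
have n1E' k : (n1 k)%:R = a * s k by rewrite sE mulrA -expr2 aa n1E.
have NE k : (n1 k * n2 k)%:R = s k ^+ 2 by rewrite sqr_sqrtr.
pose c := a + a^-1.
have c0 : 0 < c by rewrite addr_gt0 // invr_gt0.
have VE k : (n1 k + n2 k)%:R = c * s k by rewrite natrD n1E' n2E mulrDl.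
have sn k : (n1 k)%:R <= s k by rewrite n1E' ler_piMl // sqrtr_ge0.
have soo : s @ \oo --> +oo.
  apply/cvgryPge => A; near=> k; apply: le_trans (sn k).
  apply: le_trans (ler_norm A) (ltW (lt_le_trans (truncnS_gt _) _)).
  rewrite ler_nat; near: k; exact: n1oo.
have rsV : (fun k => (Num.sqrt (s k))^-1) @ \oo --> 0.
  apply/gtr0_cvgV0.
    by near=> k; rewrite sqrtr_gt0; near: k; move/cvgryPgt : soo; apply.
  apply/cvgryPge => A; near=> k; apply: le_trans (ler_norm A) _.
  rewrite -sqrtr_sqr ler_wsqrtr //; near: k; move/cvgryPge : soo; apply.
have wV : (fun k => (w k)^-1) @ \oo --> 0.
  by apply/gtr0_cvgV0 => //; move/cvgryPgt : woo; apply.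
(* For k large, w <= N^eps with m eps <= 1/4, hence w^m <= N^(1/4), the square root of [s]. This
   makes the expected number of cycles of each fixed length o(V). *)
have power_small m : (fun k => w k ^+ m / s k) @ \oo --> 0.
  apply: (@squeeze_cvgr _ _ _ _ (fun=> 0) (fun k => (Num.sqrt (s k))^-1)) => //; last exact: cvg_cst.
  near=> k.
  have s1 : 1 <= s k by near: k; move/cvgryPge : soo; apply.
  have s0 : 0 < s k by apply: lt_le_trans s1.
  have pN : p k / ((n1 k * n2 k)%:R `^ (- (1/2) + eps k)) <= 1.
    by near: k; apply: (cvgr_le _ peps _ ltr01).
  (* Using m+1 instead of m keeps the bound meaningful at m = 0. *)
  have e1 : eps k <= (4 * m.+1%:R)^-1.
    by near: k; apply: (cvgr_le _ eps0); rewrite invr_gt0 mulr_gt0.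
  have w0 : 0 <= w k by case/andP: (p01 k) => pk _; rewrite mulr_ge0 ?sqrtr_ge0.
  apply/andP; split; first by rewrite mulr_ge0 ?exprn_ge0 // invr_ge0 ltW.
  rewrite ler_pdivrMr //; set t := Num.sqrt (s k); set N : R := (n1 k * n2 k)%:R.
  have t0 : 0 < t by rewrite sqrtr_gt0.
  have tt : t ^+ 2 = s k by rewrite sqr_sqrtr // ltW.
  rewrite -tt expr2 mulKf ?gt_eqF //.
  have N1 : 1 <= N by rewrite /N NE expr_ge1 // ltW.
  have N0 : N != 0 by rewrite gt_eqF // (lt_le_trans _ N1).
  have Nt : t = N `^ (4%:R^-1).
    have -> : N = t `^ 4%:R.
      by rewrite powR_mulrn ?(ltW t0) // /N NE -tt -exprM.
    by rewrite -powRrM mulfV ?powRr1 // ltW.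
  have wN : w k <= N `^ (eps k).
    have -> : eps k = (- (1/2) + eps k) + 2^-1 by lra.
    rewrite powRD ?N0 ?implybT // powR12_sqrt ?(le_trans _ N1) // -/(s k).
    rewrite ler_pM2r // -[leRHS]mul1r.
    by rewrite -ler_pdivrMr ?powR_gt0 ?(lt_le_trans _ N1).
  apply: le_trans (_ : (N `^ (eps k)) ^+ m <= _).
    by rewrite lerXn2r ?nnegrE ?powR_ge0.
  rewrite -powR_mulrn ?powR_ge0 // -powRrM Nt ler_powR //.
  apply: (@le_trans _ _ ((4 * m.+1%:R)^-1 * m.+1%:R)).
    apply: (@le_trans _ _ ((4 * m.+1%:R)^-1 * m%:R)); first by rewrite ler_wpM2r.
    by rewrite ler_wpM2l ?ler_nat // invr_ge0 mulr_ge0.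
  by rewrite invfM -mulrA mulVf ?mulr1.
pose q j k := Gnnp_prob (p k) (fun S : {set 'I_(n1 k) * 'I_(n2 k)} =>
  ((1 - harmonic j) * (1/2 * p k * (n1 k * n2 k)%:R) <= (bip_genus S)%:R)
  && ((bip_genus S)%:R <= 1/2 * p k * (n1 k * n2 k)%:R)).
have err L : (fun k => genus_error (n1 k) (n2 k) (p k) L) @ \oo --> 0.
  (* This is [genus_error] after substituting p = w/s, with every term a constant times a null
     sequence. *)
  pose F k := 4 * (w k ^+ 1 / s k) + 2 * (a^-1 * (w k)^-1 + a * (w k)^-1) +
    \sum_(m < L) c^-1 * c ^+ m.+3 * (w k ^+ m.+3 / s k).
  have F0 : F @ \oo --> 0.
    have -> : 0 = 4 * 0 + 2 * (a^-1 * 0 + a * 0) +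
        \sum_(m < L) c^-1 * c ^+ m.+3 * 0 :> R.
      by rewrite big1 => [|m _]; rewrite !(mulr0, addr0).
    have cM b (f : nat -> R) : f @ \oo --> 0 -> (fun k => b * f k) @ \oo --> b * 0.
      by move=> f0; apply: cvgM => //; apply: cvg_cst.
    apply: cvgD; last first.
      by apply: cvg_big => [|m _]; [exact: add_continuous | exact: cM].
    apply: cvgD; first exact: cM.
    by apply: cvgM; [exact: cvg_cst | apply: cvgD; apply: cM].
  apply: cvg_trans F0; apply: near_eq_cvg; near=> k.
  have s0 : s k != 0 by rewrite gt_eqF //; near: k; move/cvgryPgt : soo; apply.
  rewrite /F /genus_error expr1 VE n1E' n2E; congr (_ + _ + _).
  - by rewrite /w mulfK.
  - by rewrite !(mulrCA (p k)) -/(w k) !invfM invrK.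
  rewrite big_distrr; apply: eq_bigr => m _ /=.
  have -> : c * s k * p k = c * w k by rewrite /w; ring.
  by rewrite [(c * w k) ^+ _]exprMn invfM [RHS]mulrACA [(s k)^-1 * _]mulrC.
have qj j : q j @ \oo --> (1 : R).
  (* The least cutoff with 4 <= L/(j+1), as [genus_prob_ge] asks for e = 1/(j+1). *)
  pose L := (4 * j.+1)%N.
  apply: (@squeeze_cvgr _ _ _ _ (fun k => 1 - genus_error (n1 k) (n2 k) (p k) L) (fun=> 1)).
  - near=> k; apply/andP; split; last exact: Gnnp_prob_le1.
    have s0 : 0 < s k by near: k; move/cvgryPgt : soo; apply.
    have w0 : 0 < w k by near: k; move/cvgryPgt : woo; apply.
    have p0 : 0 < p k by rewrite -(pmulr_lgt0 _ s0).
    have n1p : (0 < n1 k)%N by near: k; exact: n1oo.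
    apply: genus_prob_ge => //.
    + by rewrite -(ltr0n R) n2E mulr_gt0 ?invr_gt0.
    + by case/andP: (p01 k).
    + by rewrite /L natrM mulrCA mulVf ?mulr1.
    (* As V = c s and pN = w s, the condition becomes w >= 12 c (j+1), true for large k. *)
    rewrite VE NE expr2 !mulrA ler_pM2r // -mulrA -/(w k) -ler_pdivrMl ?harmonic_gt0 //.
    near: k; move/cvgryPge : woo; apply.
  - rewrite -[X in _ --> X]subr0; apply: cvgB => //; exact: cvg_cst.
  - exact: cvg_cst.
(* The error 1/(j+1) was fixed so far; it now shrinks along [J]. *)
have [J Joo qJ] := diagonal_cvg qj.
exists (fun k => harmonic (J k)); split => //.
exact: cvg_comp Joo cvg_harmonic.
Unshelve. all: by end_near. Qed.
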